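(* Let $p(x,y):=y(y-x^\ell)$, where $\ell\in\mathbb{N}\setminus\{1\}$. Then, for every $n\ge\ell+1$, there exists a truncated sequence $\beta^{(2n)}$ having the $k$-extension property relative to $\{1,p,-p\}$ for every $k\in\mathbb{N}_0$, but admitting no $\mathcal{Z}_p$-representing measure.
   Context: Here $\mathbb{N}=\{1,2,\ldots\}$, $\mathbb{N}_0=\mathbb{N}\cup\{0\}$, $\mathcal{P}_m=\{f\in\mathbb{R}[x,y]:\deg f\le m\}$, and $\mathcal{Z}_p=\{(x,y)\in\mathbb{R}^2:p(x,y)=0\}$. A truncated (bivariate) sequence of degree $2n$ is a family of real numbers $\beta\equiv\beta^{(2n)}=\{\beta_{i,j}\}_{i,j\in\mathbb{N}_0,\,i+j\le 2n}$. Its Riesz functional is the linear map $L_\beta:\mathcal{P}_{2n}\to\mathbb{R}$ with $L_\beta(x^iy^j)=\beta_{i,j}$. Let $\mathcal{B}_m$ denote the set of monomials of degree at most $m$. The moment matrix $M(n)\equiv M(n;\beta)$ is the symmetric matrix indexed by $\mathcal{B}_n\times\mathcal{B}_n$ whose entry at monomials $(u,v)$ is $L_\beta(uv)$. For a polynomial $f$ of degree $\delta\le 2n$, the localizing matrix $M_f(n)\equiv M_f(n;\beta)$ is the symmetric matrix indexed by $\mathcal{B}_{n-\lceil\delta/2\rceil}\times\mathcal{B}_{n-\lceil\delta/2\rceil}$ whose entry at $(u,v)$ is $L_\beta(fuv)$. For $k\in\mathbb{N}_0$, a positive extension of $M(n)$ of order $n+k$ is a moment matrix $M(n+k)\succeq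 0$ (of some truncated sequence of degree $2(n+k)$) whose principal submatrix indexed by $\mathcal{B}_n$ equals $M(n)$. The sequence $\beta^{(2n)}$ has the $k$-extension property relative to $\{1,p,-p\}$ if $M(n)$ admits a positive extension $M(n+k)$ such that $M_{p}(n+k)\succeq 0$ and $M_{-p}(n+k)\succeq 0$. A $\mathcal{Z}_p$-representing measure for $\beta^{(2n)}$ is a positive Borel measure $\mu$ on $\mathbb{R}^2$ supported on $\mathcal{Z}_p$ with $\beta_{i,j}=\int x^iy^j\,d\mu$ for all $i+j\le 2n$. *)

(* Defs.v *)
From mathcomp Require Import all_boot all_order all_algebra mpoly.
From mathcomp Require Import classical_sets reals ereal measure.
From mathcomp Require Import lebesgue_measure lebesgue_integral.

(* [all_analysis] is not imported: its notations clash with those of [mpoly]. *)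

Set Implicit Arguments.
Unset Strict Implicit.
Unset Printing Implicit Defensive.

Import Order.TTheory GRing.Theory Num.Theory.

Local Open Scope classical_set_scope.
Local Open Scope ring_scope.

(* The monomial x^i y^j is the [m : 'X_{1..2}] with [m ord0 = i] and
   [m ord_max = j]; its degree [mdeg m] is i + j. *)
Definition varx {R : realType} : {mpoly R[2]} := 'X_ord0.
Definition vary {R : realType} : {mpoly R[2]} := 'X_ord_max.

Notation monomials d := 'X_{1..2 < d.+1}.
Notation nb_monomials d := #|{: monomials d}|.

Definition monomial_at (d : nat) (i : 'I_(nb_monomials d)) : monomials d :=
  enum_val i.

Definition truncated_sequence (R : realType) (d : nat) := monomials d -> R.

(* Coefficients of degree > d are ignored; below, [riesz beta] is only applied
   to polynomials of degree <= d. *)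
Definition riesz (R : realType) (d : nat) (beta : truncated_sequence R d)
    (f : {mpoly R[2]}) : R :=
  \sum_(m : monomials d) f@_m * beta m.

Definition moment_mx (R : realType) (n : nat)
    (beta : truncated_sequence R (2 * n)) : 'M[R]_(nb_monomials n) :=
  \matrix_(i, j) riesz beta ('X_[monomial_at i] * 'X_[monomial_at j]).

(* n - ceil (deg f / 2); recall that [msize f] is deg f + 1. *)
Definition localizing_order (R : realType) (f : {mpoly R[2]}) (n : nat) : nat :=
  (n - uphalf (msize f).-1)%N.

(* Meaningful for deg f <= 2n only. *)
Definition localizing_mx (R : realType) (f : {mpoly R[2]}) (n : nat)
    (beta : truncated_sequence R (2 * n)) :
    'M[R]_(nb_monomials (localizing_order f n)) :=
  \matrix_(i, j) riesz beta (f * 'X_[monomial_at i] * 'X_[monomial_at j]).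

Definition psd (R : realType) (n : nat) (A : 'M[R]_n) : Prop :=
  A^T = A /\ forall v : 'cV[R]_n, 0 <= (v^T *m A *m v) ord0 ord0.

Definition widen_monomial (d e : nat) (le_de : (d <= e)%N)
    (m : monomials d) : monomials e :=
  BMultinom (leq_trans (bmdeg m) (le_de : (d.+1 <= e.+1)%N)).

Definition widen_index (n k : nat) (i : 'I_(nb_monomials n)) :
    'I_(nb_monomials (n + k)) :=
  enum_rank (widen_monomial (leq_addr k n) (monomial_at i)).

Definition positive_extension (R : realType) (n k : nat)
    (beta : truncated_sequence R (2 * n))
    (gamma : truncated_sequence R (2 * (n + k))) : Prop :=
  psd (moment_mx gamma) /\
  mxsub (@widen_index n k) (@widen_index n k) (moment_mx gamma)
    = moment_mx beta.

(* The k-extension property relative to {1, p, -p}. *)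
Definition extension_property (R : realType) (p : {mpoly R[2]}) (k n : nat)
    (beta : truncated_sequence R (2 * n)) : Prop :=
  exists gamma : truncated_sequence R (2 * (n + k)),
    [/\ positive_extension beta gamma,
        psd (localizing_mx p gamma) & psd (localizing_mx (- p) gamma)].

Definition zero_set (R : realType) (p : {mpoly R[2]}) : set (R * R) :=
  [set z | p.@[fun i : 'I_2 => if i == ord0 then z.1 else z.2] = 0].

(* The product sigma-algebra carried by [R * R] is the Borel one of the plane.
   As [zero_set p] is closed, mu is supported on it iff its complement is
   null. *)
Definition representing_measure (R : realType) (p : {mpoly R[2]}) (n : nat)
    (beta : truncated_sequence R (2 * n))
    (mu : {measure set (R * R) -> \bar R}) : Prop :=
  mu (~` zero_set p) = 0%E /\
  forall m : monomials (2 * n),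
    let mono (z : R * R) := (z.1 ^+ m ord0 * z.2 ^+ m ord_max)%:E in
    mu.-integrable setT mono /\
    (\int[mu]_(z in setT) mono z = (beta m)%:E)%E.

(* Main.v *)
Require Import Defs.
From mathcomp Require Import all_boot all_order all_algebra mpoly.
From mathcomp Require Import classical_sets reals ereal measure.
From mathcomp Require Import lebesgue_measure lebesgue_integral.
From mathcomp Require Import measurable_realfun.
From mathcomp Require Import zify ring lra.

(** Write p = y (y - x^l).  A single linear functional L on R[x,y] gives both
    halves of the statement: L vanishes on the ideal (p), L (g^2) >= 0 for every
    g, and L (F) < 0 for a polynomial F of degree at most l + 1 that is
    nonnegative on the zero set of p.  The truncations of L are then positive
    extensions of one another with vanishing localizing matrices, while a
    representing measure would give L (F) = \int F >= 0.

    Such an F exists because the components y = 0 and y = x^l meet at the origin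
    with multiplicity l >= 2: on both of them F = y + x^(2h) + x^(2u), with
    h = floor (l/2) and u = ceil (l/2), is nonnegative ([test_poly_ge0]), the
    monomial y being 0 or x^h x^u.  It is nevertheless not a sum of squares
    modulo p, since such a sum without constant term has no term y either.

    Modulo p, the monomials x^i and x^i y form a basis, so L may be prescribed
    freely on them.  Order them as if x^i had rank 2i and x^i y, which equals
    x^(i+l) on the curve, had rank 2(i+l) - 1.  The value of L on a product of
    two basis elements is then essentially a function of the sum of the ranks,
    and, in the Gram matrix of L, the diagonal entry of rank r sits strictly
    later in this order than every entry of the row r left of the diagonal
    ([moment_mul], [pairing]).  If the values of L grow fast enough along the
    order, each diagonal entry dominates everything before it and the Gram matrix
    is positive definite in all degrees ([dominant_form_ge]).  The moment of y
    occurs in the Gram matrix only as the entry of 1 and y.  Hence it may be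
    given any value, even a negative one, that the diagonal entry of y
    dominates; as the moments of x^(2h) and x^(2u) come well before that entry,
    L (y) = - L (x^(2h)) - L (x^(2u)) - 1 is such a value, and L (F) = -1. *)

Import Order.TTheory GRing.Theory Num.Theory.

Local Open Scope ring_scope.

(** * Quadratic forms with a fast growing diagonal *)

(** Adding the variable of index N costs at most half of the lower bound
    2^-N already obtained for the previous ones: Young's inequality moves the
    rest of the cross terms onto the new diagonal entry, which is large enough
    to absorb it. *)
Lemma dominant_form_ge (R : realType) (a : nat -> nat -> R)
    (a_sym : forall r s, a r s = a s r)
    (a_dom : forall r, 1 + 2 ^+ r.+1 * (\sum_(s < r) a r s ^+ 2) <= a r r)
    (N : nat) (v : nat -> R) :
  2 ^- N * (\sum_(r < N) v r ^+ 2)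
    <= \sum_(r < N) \sum_(s < N) a r s * v r * v s.
Proof.
elim: N => [|N IH]; first by rewrite !big_ord0 mulr0.
have split_form : \sum_(r < N.+1) \sum_(s < N.+1) a r s * v r * v s =
    \sum_(r < N) \sum_(s < N) a r s * v r * v s
    + \sum_(s < N) (a N s * v N * v s) *+ 2 + a N N * v N ^+ 2.
  rewrite big_ord_recr /= big_ord_recr /=.
  under eq_bigr => r _ do rewrite big_ord_recr /=.
  rewrite big_split /= expr2 mulrA addrA; congr (_ + _).
  rewrite -addrA -big_split /=; congr (_ + _).
  apply: eq_bigr => r _; rewrite (a_sym r N) mulr2n; congr (_ + _).
  by rewrite mulrAC.
have pow_gt0 : 0 < 2 ^+ N :> R by rewrite exprn_gt0.
(* Young's inequality, each cross term giving away half of its share of the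
   bound on the first N variables *)
have cross : - (2 ^- N.+1 * (\sum_(s < N) v s ^+ 2))
    - 2 ^+ N.+1 * (\sum_(s < N) a N s ^+ 2) * v N ^+ 2
    <= \sum_(s < N) (a N s * v N * v s) *+ 2.
  rewrite !mulr_sumr mulr_suml -!sumrN -big_split /=.
  apply: ler_sum => s _; rewrite exprS.
  set t := 2 ^+ N in pow_gt0 *; set c := a N s; set x := v N; set y := v s.
  have -> : c * x * y *+ 2
      = (2 * t)^-1 * (y + 2 * t * c * x) ^+ 2
        - (2 * t)^-1 * y ^+ 2 - 2 * t * c ^+ 2 * x ^+ 2.
    by field; rewrite gt_eqF.
  rewrite -addrA lerDr mulr_ge0 ?sqr_ge0// invr_ge0 mulr_ge0// ltW//.
have dom := a_dom N.
have dom_v : (1 + 2 ^+ N.+1 * (\sum_(s < N) a N s ^+ 2)) * v N ^+ 2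
    <= a N N * v N ^+ 2 by rewrite ler_wpM2r ?sqr_ge0.
have inv_le1 : 2 ^- N.+1 * v N ^+ 2 <= v N ^+ 2.
  rewrite ler_piMl ?sqr_ge0// invf_le1 ?exprn_gt0//.
  by rewrite exprn_ege1// ler1n.
have halves : 2 ^- N = 2 * 2 ^- N.+1 :> R.
  by rewrite exprS; field; rewrite gt_eqF.
rewrite split_form big_ord_recr /= mulrDr.
rewrite halves in IH.
move: IH cross dom_v inv_le1.
set S := \sum_(s < N) v s ^+ 2; set D := \sum_(s < N) a N s ^+ 2.
set Q := \sum_(r < N) _; set C := \sum_(s < N) _.
set u := 2 ^- N.+1; set x := v N ^+ 2; set w := 2 ^+ N.+1.
by rewrite mulrDl mul1r; lra.
Qed.

(** Grouping the variables of equal rank, i.e. adding the coefficients of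
    monomials that agree modulo p, turns this form into the previous one. *)
Lemma ranked_form_ge0 (R : realType) (a : nat -> nat -> R)
    (a_sym : forall r s, a r s = a s r)
    (a_dom : forall r, 1 + 2 ^+ r.+1 * (\sum_(s < r) a r s ^+ 2) <= a r r)
    (T : finType) (rk : T -> nat) (v : T -> R) :
  0 <= \sum_i \sum_j a (rk i) (rk j) * v i * v j.
Proof.
pose N := (\max_i rk i).+1.
have rkN i : (rk i < N)%N by rewrite ltnS; exact: (leq_bigmax i).
pose V (r : nat) := \sum_(i | rk i == r) v i.
have byrank (F : T -> R) : \sum_i F i = \sum_(r < N) \sum_(i | rk i == r) F i.
  by rewrite (partition_big (fun i => Ordinal (rkN i)) predT) //=.
suff -> : \sum_i \sum_j a (rk i) (rk j) * v i * v j
    = \sum_(r < N) \sum_(s < N) a r s * V r * V s.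
  apply: le_trans (dominant_form_ge _ _ a_sym a_dom N V).
  by rewrite mulr_ge0 ?invr_ge0 ?exprn_ge0// sumr_ge0// => r _; rewrite sqr_ge0.
rewrite byrank; apply: eq_bigr => r _.
under eq_bigr => i _ do rewrite byrank.
rewrite exchange_big /=; apply: eq_bigr => s _.
rewrite mulr_sumr exchange_big /=; apply: eq_bigr => j /eqP rj.
by rewrite mulr_sumr mulr_suml; apply: eq_bigr => i /eqP ri; rewrite ri rj.
Qed.

(** * The Gram matrix of the functional *)

Fixpoint weight (R : realType) (m : nat) : R :=
  if m is m'.+1 then 1 + 4 ^+ m * weight R m' ^+ 2 else 1.

Lemma weight_ge1 (R : realType) (m : nat) : 1 <= weight R m.
Proof. by case: m => [|m] //=; rewrite lerDl mulr_ge0 ?sqr_ge0 ?exprn_ge0. Qed.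

Lemma weight_ge0 (R : realType) (m : nat) : 0 <= weight R m.
Proof. exact: le_trans ler01 (weight_ge1 R m). Qed.

Lemma weight_double (R : realType) (m : nat) :
  2 * weight R m + 1 <= weight R m.+1.
Proof.
have w1 := weight_ge1 R m; rewrite /=.
have p4 : 4 <= 4 ^+ m.+1 :> R.
  by rewrite exprS ler_peMr// exprn_ege1// ler1n.
nra.
Qed.

Lemma weight_le (R : realType) (m m' : nat) :
  (m <= m')%N -> weight R m <= weight R m'.
Proof.
move=> /subnK <-; elim: (m' - m)%N => // d IH.
rewrite addSn; apply: le_trans IH _.
have := weight_double R (d + m); have := weight_ge1 R (d + m); lra.
Qed.

(** The opposite of the moment of y; the summand 1 makes L (F) = -1. *)
Definition defect (R : realType) (l : nat) : R :=
  weight R l./2.*2.*2 + weight R (uphalf l).*2.*2 + 1.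

(** The square of y has rank sum 4l - 2, so the row of y in the Gram matrix
    tolerates entries up to the weight of 4l - 3.  The two weights in the defect
    have index at most 4(l-1), and one step of growth more than doubles them. *)
Lemma defect_le (R : realType) (l m : nat) :
  (2 <= l)%N -> (l.*2.*2 <= m.+3)%N -> 0 <= defect R l <= weight R m.
Proof.
move=> hl lm; rewrite /defect.
have w1 := weight_ge1 R l./2.*2.*2.
have w2 := weight_ge1 R (uphalf l).*2.*2.
have hu : (l./2 <= uphalf l <= l.-1)%N by lia.
case: m lm => [|m] lm; first by lia.
have w3 := weight_double R m.
have l1 : (l./2.*2.*2 <= m)%N by lia.
have l2 : ((uphalf l).*2.*2 <= m)%N by lia.
have w4 := weight_le R _ _ l1.
have w5 := weight_le R _ _ l2.
lra.
Qed.

(** The value of the functional on the product of the basis elements of ranks r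
    and s.  Two factors x^i y and x^j y have product x^(i+j+l) y modulo p, of
    rank r + s + 1, whence the correction term.  The exceptional entry is that of
    1 and y.  Odd ranks below 2l - 1 belong to no monomial; they only make the
    indexing uniform. *)
Definition pairing (R : realType) (l r s : nat) : R :=
  if (r * s == 0)%N && (r + s == l.*2.-1)%N then - defect R l
  else weight R (r + s + (odd r && odd s)).

Lemma pairingC (R : realType) (l r s : nat) : pairing R l r s = pairing R l s r.
Proof. by rewrite /pairing mulnC addnC (andbC (odd r)). Qed.

(** Left of the diagonal, the row r involves weights of index at most 2r - 1: two
    odd ranks r > s differ by at least 2.  The diagonal weight has index at least
    2r, and the weight of index 2r exceeds the square of the previous one by a
    factor 4^(2r), which covers the r terms of the sum. *)
Lemma pairing_dominant (R : realType) (l : nat) (hl : (2 <= l)%N) (r : nat) :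
  1 + 2 ^+ r.+1 * (\sum_(s < r) pairing R l r s ^+ 2) <= pairing R l r r.
Proof.
case: r => [|r].
  rewrite big_ord0 mulr0 addr0 /pairing /=.
  by case: eqP => [l0|_]; first (exfalso; lia).
have diag : pairing R l r.+1 r.+1 = weight R (r.+1 + r.+1 + odd r.+1).
  by rewrite /pairing andbb mulnS.
have off (s : 'I_r.+1) : pairing R l r.+1 s ^+ 2 <= weight R (r + r.+1) ^+ 2.
  rewrite -[leLHS]real_normK ?num_real// lerXn2r ?nnegrE ?weight_ge0//.
  rewrite /pairing; case: ifP => [/andP[/eqP s0 /eqP rs]|_].
    have /andP[d0 dw] : 0 <= defect R l <= weight R (r + r.+1).
      apply: defect_le => //; lia.
    by rewrite normrN ger0_norm.
  rewrite ger0_norm ?weight_ge0//.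
  apply: weight_le; have sr := ltn_ord s.
  have [->|nsr] := eqVneq (s : nat) r; first by rewrite /= andNb addn0 addnC.
  have := leq_b1 (odd r.+1 && odd s); lia.
rewrite diag; apply: le_trans (_ : weight R (r + r.+1).+1 <= _); last first.
  by apply: weight_le; lia.
rewrite /= lerD2l.
apply: le_trans
  (_ : 2 ^+ r.+2 * (\sum_(s < r.+1) weight R (r + r.+1) ^+ 2) <= _).
  by rewrite ler_wpM2l ?exprn_ge0// ler_sum.
rewrite sumr_const card_ord -[_ *+ r.+1]mulr_natl mulrA ler_wpM2r ?sqr_ge0//.
rewrite -[4]/((2 ^ 2)%N%:R) -!natrX -natrM ler_nat -expnM.
apply: leq_trans (_ : 2 ^ r.+2 * 2 ^ r.+1 <= _)%N.
  by rewrite leq_mul2l ltnW ?orbT// ltn_expl.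
rewrite -expnD leq_exp2l//; lia.
Qed.

(** * Positivity and extensions *)

Definition monom (i j : nat) : 'X_{1..2} :=
  (U_(ord0) *+ i + U_(ord_max) *+ j)%MM.

Lemma monom_x (i j : nat) : monom i j ord0 = i.
Proof. by rewrite mnmDE !mulmnE !mnm1E /= mul1n mul0n addn0. Qed.

Lemma monom_y (i j : nat) : monom i j ord_max = j.
Proof. by rewrite mnmDE !mulmnE !mnm1E /= mul1n mul0n. Qed.

Lemma mdeg_monom (i j : nat) : mdeg (monom i j) = (i + j)%N.
Proof. by rewrite mdegD !mdegMn !mdeg1 !mul1n. Qed.

(** The rank of x^i y^j modulo p, where y^j = x^(l(j-1)) y for j > 0. *)
Definition curve_rank (l : nat) (m : 'X_{1..2}) : nat :=
  if m ord_max == 0%N then (m ord0).*2 else (m ord0 + l * m ord_max).*2.-1.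

(** The functional on monomials, read off from the row of the unit. *)
Definition moment (R : realType) (l : nat) (m : 'X_{1..2}) : R :=
  pairing R l 0 (curve_rank l m).

(** The exceptional value occurs on both sides for the same products: for l > 0,
    a product of two monomials equals y modulo p only as 1 * y or y * 1. *)
Lemma moment_mul (R : realType) (l : nat) (hl : (2 <= l)%N) (m m' : 'X_{1..2}) :
  moment R l (m + m') = pairing R l (curve_rank l m) (curve_rank l m').
Proof.
rewrite /moment /pairing /curve_rank !mnmDE mul0n eqxx add0n /=.
move: (m ord0) (m ord_max) (m' ord0) (m' ord_max) => i j i' j'.
have odd_pred k : (0 < k)%N -> odd k.*2.-1.
  by case: k => // k _; rewrite doubleS /= odd_double.
have pos a b : (0 < b)%N -> (0 < a + l * b)%N.
  by move=> b0; rewrite addn_gt0 muln_gt0 b0 (ltnW hl) orbT.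
case: j j' => [|j] [|j'] /=;
  rewrite ?odd_double ?andbF ?addn0 ?mulnDr ?muln0 ?add0n.
- rewrite -doubleD; case: eqP => [e|_]; first by exfalso; lia.
  by rewrite andbF.
- have := pos i' j'.+1 isT; set b := (l * _)%N => ib0.
  have -> : (i + i' + b).*2.-1 = (i.*2 + (i' + b).*2.-1)%N by lia.
  have bl : (l <= b)%N by rewrite leq_pmulr.
  case: eqP => [e|_]; rewrite ?andbF ?andFb//= andbT.
  case: eqP => [//|ne]; exfalso; apply: ne.
  have -> : i = 0%N by lia.
  by rewrite mul0n.
- have := pos i j.+1 isT; set b := (l * _)%N => ib0.
  have -> : (i + i' + b).*2.-1 = ((i + b).*2.-1 + i'.*2)%N by lia.
  have bl : (l <= b)%N by rewrite leq_pmulr.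
  case: eqP => [e|_]; rewrite ?andbF ?andFb//= andbT.
  case: eqP => [//|ne]; exfalso; apply: ne.
  have -> : i' = 0%N by lia.
  by rewrite muln0.
- have := pos i j.+1 isT; have := pos i' j'.+1 isT.
  have : (l <= l * j.+1)%N by rewrite leq_pmulr.
  have : (l <= l * j'.+1)%N by rewrite leq_pmulr.
  set b := (l * j.+1)%N; set b' := (l * j'.+1)%N => lb lb' ib0 ib0'.
  rewrite !odd_pred// muln_eq0.
  case: eqP => [e|_]; first by exfalso; lia.
  case: eqP => [e|_] /=; first by exfalso; lia.
  case: eqP => [e|_] /=; first by exfalso; lia.
  by congr weight; lia.
Qed.

Lemma moment_curve (R : realType) (l : nat) (m : 'X_{1..2}) : (1 <= l)%N ->
  moment R l (monom 0 2 + m) = moment R l (monom l 1 + m).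
Proof.
move=> hl; rewrite /moment /curve_rank !(mnmDE _ _ m) !monom_x !monom_y /=.
congr (pairing _ _ _ _); lia.
Qed.

Definition curve_sequence (R : realType) (l d : nat) : truncated_sequence R d :=
  fun m => moment R l m.

Lemma rieszB (R : realType) (d : nat) (beta : truncated_sequence R d) f g :
  riesz beta (f - g) = riesz beta f - riesz beta g.
Proof.
by rewrite /riesz -sumrB; apply: eq_bigr => m _; rewrite mcoeffB mulrBl.
Qed.

Lemma rieszN (R : realType) (d : nat) (beta : truncated_sequence R d) f :
  riesz beta (- f) = - riesz beta f.
Proof.
by rewrite /riesz -sumrN; apply: eq_bigr => m _; rewrite mcoeffN mulNr.
Qed.

Lemma rieszX (R : realType) (l d : nat) (m : 'X_{1..2}) : (mdeg m <= d)%N ->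
  riesz (curve_sequence R l d) 'X_[m] = moment R l m.
Proof.
move=> md; rewrite /riesz (bigD1 (BMultinom (md : mdeg m < d.+1)%N)) //=.
rewrite mcoeffX eqxx mul1r big1 ?addr0// => m' ne.
rewrite eq_sym -val_eqE /= in ne.
by rewrite mcoeffX (negPf ne) mul0r.
Qed.

Lemma moment_mxE (R : realType) (l n : nat) i j :
  moment_mx (curve_sequence R l (2 * n)) i j
  = moment R l (monomial_at i + monomial_at j).
Proof.
rewrite mxE -mpolyXD rieszX// mdegD.
have := bmdeg (monomial_at i); have := bmdeg (monomial_at j); lia.
Qed.

Lemma moment_mx_psd (R : realType) (l n : nat) (hl : (2 <= l)%N) :
  psd (moment_mx (curve_sequence R l (2 * n))).
Proof.
split; first by apply/matrixP => i j; rewrite mxE !moment_mxE addmC.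
move=> v.
pose rk (i : 'I_(nb_monomials n)) := curve_rank l (monomial_at i).
suff -> : (v^T *m moment_mx (curve_sequence R l (2 * n)) *m v) ord0 ord0
    = \sum_i \sum_j pairing R l (rk i) (rk j) * v i ord0 * v j ord0.
  exact: (ranked_form_ge0 _ _ (pairingC R l) (pairing_dominant R l hl)).
rewrite mxE exchange_big /=; apply: eq_bigr => j _.
rewrite mxE mulr_suml; apply: eq_bigr => i _.
by rewrite moment_mxE moment_mul// mxE [v i _ * _]mulrC.
Qed.

Definition curve_poly (R : realType) (l : nat) : {mpoly R[2]} :=
  vary * (vary - varx ^+ l).

Lemma curve_polyE (R : realType) (l : nat) :
  curve_poly R l = 'X_[monom 0 2] - 'X_[monom l 1].
Proof.
rewrite /curve_poly /monom !mpolyXD -!mpolyXn -/varx -/vary.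
by rewrite expr0 expr1 mul1r mulrBr [vary * varx ^+ l]mulrC.
Qed.

Lemma leq_msize_curve_poly (R : realType) (l : nat) :
  (1 <= l)%N -> (l.+2 <= msize (curve_poly R l))%N.
Proof.
move=> hl; have <- : mdeg (monom l 1) = l.+1 by rewrite mdeg_monom addn1.
apply: msize_mdeg_lt; rewrite mcoeff_msupp curve_polyE mcoeffB !mcoeffX eqxx.
have /negPf -> : monom 0 2 != monom l 1.
  by apply/eqP => /(congr1 (fun m : 'X_{1..2} => m ord_max)); rewrite !monom_y.
by rewrite sub0r oppr_eq0 oner_neq0.
Qed.

Lemma riesz_curve_poly (R : realType) (l d : nat) (m : 'X_{1..2}) :
  (1 <= l)%N -> (l.+1 + mdeg m <= d)%N ->
  riesz (curve_sequence R l d) (curve_poly R l * 'X_[m]) = 0.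
Proof.
move=> hl md; rewrite curve_polyE mulrBl -!mpolyXD rieszB.
by rewrite !rieszX ?moment_curve ?subrr// mdegD mdeg_monom; lia.
Qed.

Lemma psd0 (R : realType) (n : nat) : psd (0 : 'M[R]_n).
Proof.
by split=> [|v]; rewrite ?trmx0// mulmx0 mul0mx mxE.
Qed.

(** As p has degree at least l + 1, the entries of its localizing matrices are
    values of the functional on multiples of p of degree at most 2n. *)
Lemma localizing_mx_eq0 (R : realType) (l n : nat) (f : {mpoly R[2]}) :
  (1 <= l)%N -> (l.+1 <= 2 * n)%N ->
  f = curve_poly R l \/ f = - curve_poly R l ->
  localizing_mx f (curve_sequence R l (2 * n)) = 0.
Proof.
move=> hl ln hf; apply/matrixP => i j; rewrite !mxE.
have msf : (l.+2 <= msize f)%N.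
  by case: hf => ->; rewrite ?msizeN; exact: leq_msize_curve_poly.
have di := bmdeg (monomial_at i); have dj := bmdeg (monomial_at j).
have deg : (l.+1 + mdeg (monomial_at i + monomial_at j) <= 2 * n)%N.
  rewrite mdegD; move: di dj; rewrite /localizing_order; lia.
rewrite -mulrA -mpolyXD; move: (_ + _)%MM deg => m deg {i j di dj msf}.
by case: hf => ->; rewrite ?mulNr ?rieszN riesz_curve_poly ?oppr0.
Qed.

Lemma curve_sequence_extension (R : realType) (l n k : nat) :
  (2 <= l)%N -> (l.+1 <= 2 * n)%N ->
  extension_property (curve_poly R l) k (curve_sequence R l (2 * n)).
Proof.
move=> hl ln; exists (curve_sequence R l (2 * (n + k))).
have ln' : (l.+1 <= 2 * (n + k))%N by lia.
split; first split.
- exact: moment_mx_psd.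
- apply/matrixP => i j; rewrite mxE !moment_mxE.
  by rewrite /monomial_at /widen_index !enum_rankK.
- rewrite localizing_mx_eq0 ?(ltnW hl)//; [exact: psd0 | by left].
- rewrite localizing_mx_eq0 ?(ltnW hl)//; [exact: psd0 | by right].
Qed.

(** * Absence of representing measures *)

Lemma zero_set_curve (R : realType) (l : nat) :
  zero_set (curve_poly R l) = [set z | z.2 * (z.2 - z.1 ^+ l) = 0]%classic.
Proof.
by apply/seteqP; split => z;
  rewrite /zero_set /= mevalM mevalB rmorphXn /= !mevalXU.
Qed.

Lemma measurable_zero_set_curve (R : realType) (l : nat) :
  measurable (zero_set (curve_poly R l)).
Proof.
rewrite zero_set_curve.
have mf : measurable_fun setT (fun z : R * R => z.2 * (z.2 - z.1 ^+ l)).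
  apply: measurable_funM => //; apply: measurable_funB => //.
  exact: measurable_funX.
rewrite -[X in measurable X]setTI.
exact: (mf measurableT [set 0]%classic (measurable_set1 0)).
Qed.

(** On the component y = 0 this is a^2 + b^2, and on y = x^l it is
    a^2 + a b + b^2, where a = x^h, b = x^u and h + u = l. *)
Lemma test_poly_ge0 (R : realType) (l : nat) (z : R * R) :
  zero_set (curve_poly R l) z ->
  0 <= z.2 + z.1 ^+ l./2.*2 + z.1 ^+ (uphalf l).*2.
Proof.
rewrite zero_set_curve /= => /eqP; rewrite mulf_eq0 subr_eq0.
rewrite -!muln2 !exprM.
set a := z.1 ^+ l./2; set b := z.1 ^+ uphalf l.
case/orP => /eqP ->; first by rewrite add0r addr_ge0 ?sqr_ge0.
have -> : z.1 ^+ l = a * b by rewrite -exprD; congr (_ ^+ _); lia.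
nra.
Qed.

(** The integrand may be replaced by its absolute value, which agrees with it
    outside a null set. *)
Lemma ae_ge0_integral_ge0 d (T : measurableType d) (R : realType)
    (mu : {measure set T -> \bar R}) (A : set T) (f : T -> R) :
  measurable A -> mu (~` A)%classic = 0%E -> measurable_fun setT f ->
  (forall z, A z -> 0 <= f z) -> (0 <= \int[mu]_z (f z)%:E)%E.
Proof.
move=> mA muA mf f0.
rewrite (ae_eq_integral (fun z => `|f z|%:E)) //=.
- by apply: integral_ge0 => z _; rewrite lee_fin.
- exact/measurable_EFinP.
- by apply/measurable_EFinP; exact: measurableT_comp.
- exists (~` A)%classic; split => //; first exact: measurableC.
  move=> z /= nz Az; apply: nz => _; rewrite ger0_norm// f0//.
Qed.

Lemma no_representing_measure (R : realType) (l n : nat) :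
  (2 <= l)%N -> (l.+1 <= 2 * n)%N ->
  ~ exists mu : {measure set (R * R) -> \bar R},
      representing_measure (curve_poly R l) (curve_sequence R l (2 * n)) mu.
Proof.
move=> hl ln [mu [mu0 rep]].
have repm i j : (i + j <= 2 * n)%N ->
    mu.-integrable setT (fun z : R * R => (z.1 ^+ i * z.2 ^+ j)%:E) /\
    (\int[mu]_z (z.1 ^+ i * z.2 ^+ j)%:E = (moment R l (monom i j))%:E)%E.
  move=> ij; have md : (mdeg (monom i j) < (2 * n).+1)%N by rewrite mdeg_monom.
  by have := rep (BMultinom md); rewrite /curve_sequence /= monom_x monom_y.
have [iy Ey] := repm 0%N 1%N ltac:(lia).
have [ih Eh] := repm l./2.*2 0%N ltac:(lia).
have [iu Eu] := repm (uphalf l).*2 0%N ltac:(lia).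
have : (0 <= \int[mu]_z (z.2 + z.1 ^+ l./2.*2 + z.1 ^+ (uphalf l).*2)%:E)%E.
  apply: (ae_ge0_integral_ge0 _ _ _ _ _ _ (measurable_zero_set_curve R l) mu0).
    by apply: measurable_funD; [apply: measurable_funD|] => //;
       exact: measurable_funX.
  exact: test_poly_ge0.
(* exhibits the three terms as the monomials x^0 y^1, x^(2h) y^0, x^(2u) y^0 *)
under eq_integral => z _.
  rewrite -[z.2](mul1r) -(expr0 z.1) -(expr1 z.2).
  rewrite -[z.1 ^+ l./2.*2]mulr1 -[z.1 ^+ (uphalf l).*2]mulr1 -(expr0 z.2).
  rewrite EFinD EFinD; over.
rewrite integralD//; last exact: integrableD.
rewrite integralD// Ey Eh Eu -!EFinD lee_fin.
have even_moment i : moment R l (monom i.*2 0) = weight R i.*2.*2.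
  rewrite /moment /curve_rank monom_x monom_y /= /pairing.
  rewrite mul0n add0n eqxx odd_double /=.
  by case: eqP => [e|_]; [exfalso; lia | rewrite addn0].
have y_moment : moment R l (monom 0 1) = - defect R l.
  rewrite /moment /curve_rank monom_x monom_y /= muln1.
  by rewrite /pairing mul0n !add0n !eqxx.
by rewrite y_moment !even_moment /defect; lra.
Qed.

Theorem theorem3p8 (R : realType) (l : nat) (hl : (2 <= l)%N)
    (n : nat) (hn : (l + 1 <= n)%N) :
  let p : {mpoly R[2]} := vary * (vary - varx ^+ l) in
  exists beta : truncated_sequence R (2 * n),
    (forall k : nat, extension_property p k beta) /\
    ~ (exists mu : {measure set (R * R) -> \bar R},
         representing_measure p beta mu).
Proof.
have ln : (l.+1 <= 2 * n)%N by lia.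
exists (curve_sequence R l (2 * n)); split.
- by move=> k; exact: curve_sequence_extension.
- exact: no_representing_measure.
Qed.
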